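(* There are universal constants $C_0$ (sufficiently large), $c_0>0$ (sufficiently small) and $c>0$ such that, if $C_0\log n/n\le p<1$, $0<\varepsilon<1$, and $0\le\delta\le c_0/(np)$, then $$\inf_{M\in\mathcal M^{\rm edge}_{\varepsilon,\delta}}\ \sup_{\theta\in\Theta}R_\theta(M)\ \ge\ c\left(\frac1p+\min\left\{n,\frac1{np^2\varepsilon^2}\right\}\right).$$
   Context: Bradley–Terry–Luce model: there are $n\ge2$ items. Each pair $1\le i<j\le n$ is included in the random edge set $\mathcal G$ independently with probability $p\in(0,1)$. Given $\mathcal G$, outcomes $Y_{ij}\in\{0,1\}$, $(i,j)\in\mathcal G$, are independent with $\mathbb P(Y_{ij}=1)=e^{\theta_i}/(e^{\theta_i}+e^{\theta_j})$. The parameter space is $\Theta=\{\theta\in\mathbb R^n:\|\theta\|_\infty\le1,\ \mathbf 1^\top\theta=0\}$. Edge-level privacy: the graph $\mathcal G$ is public. Two data sets are adjacent if they have the same graph and differ in the outcome of exactly one observed comparison. A randomized algorithm $M(\mathbf Y,\mathcal G)$ is edge-level $(\varepsilon,\delta)$-differentially private if for all adjacent $(y,\mathcal G),(y',\mathcal G)$ and measurable $S$, $\mathbb P(M(y,\mathcal G)\in S)\le e^\varepsilon\mathbb P(M(y',\mathcal G)\in S)+\delta$, with probability over the randomness of $M$ only. $\mathcal M^{\rm edge}_{\varepsilon,\delta}$ is the class of all such algorithms with values in $\mathbb R^n$. The risk is $R_\theta(M)=\mathbb E_{\mathcal G}\mathbb E_{\mathbf Y\mid\theta,\mathcal G}\|M(\mathbf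 Y,\mathcal G)-\theta\|_2^2$ (also averaged over the randomness of $M$). *)

(* Defs.v *)
From mathcomp Require Import all_boot all_order all_algebra.
From mathcomp Require Import all_classical all_reals all_analysis.

Set Implicit Arguments.
Unset Strict Implicit.
Unset Printing Implicit Defensive.

Import Order.TTheory GRing.Theory Num.Theory.
Local Open Scope classical_set_scope.
Local Open Scope ring_scope.

(* R^n as a measurable type: the sigma-algebra on tuples is the product of the
   Borel sigma-algebras, i.e. the Borel sigma-algebra of R^n. *)
Notation Rvec R n := (n.-tuple (measurableTypeR R)).

Definition norm_oo (R : realType) n (x : Rvec R n) : R :=
  \big[Num.max/0]_(i < n) `|tnth x i|.

Definition sqdist (R : realType) n (x y : Rvec R n) : R :=
  \sum_(i < n) (tnth x i - tnth y i) ^+ 2.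

Definition Theta (R : realType) n : set (Rvec R n) :=
  [set theta | norm_oo theta <= 1 /\ \sum_(i < n) tnth theta i = 0].

Arguments Theta R n : clear implicits.

Definition vpair n := {e : 'I_n * 'I_n | (e.1 < e.2)%N}.
Definition graph n := {set vpair n}.

(* Outcomes are recorded on the observed pairs only; [true] at (i, j) means
   Y_ij = 1. A data set is a graph [G] together with [y : outcomes G]. *)
Definition outcomes n (G : graph n) := {ffun {e : vpair n | e \in G} -> bool}.

Definition graph_prob (R : realType) (p : R) n (G : graph n) : R :=
  \prod_(e : vpair n) bernoulli_pmf p (e \in G).

Definition win_prob (R : realType) n (theta : Rvec R n) (e : vpair n) : R :=
  let ti := tnth theta (val e).1 in
  let tj := tnth theta (val e).2 in
  expR ti / (expR ti + expR tj).

Definition outcome_prob (R : realType) n (theta : Rvec R n) (G : graph n)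
    (y : outcomes G) : R :=
  \prod_(e : {e : vpair n | e \in G})
    bernoulli_pmf (win_prob theta (val e)) (y e).

(* A randomized algorithm gives the law of its output on each data set. There
   are finitely many data sets, so no measurability in the data is needed. *)
Definition mechanism (R : realType) n :=
  forall G : graph n, outcomes G -> probability (Rvec R n) R.

(* Adjacent data sets have the same graph, which the typing enforces. *)
Definition adjacent_data n (G : graph n) (y y' : outcomes G) : Prop :=
  #|[set e | y e != y' e]%SET| = 1%N.

Definition edge_private (R : realType) n (eps delta : R) :
    set (mechanism R n) :=
  [set M | forall (G : graph n) (y y' : outcomes G), adjacent_data y y' ->
     forall S : set (Rvec R n), measurable S ->
     (M G y S <= (expR eps)%:E * M G y' S + delta%:E)%E].

Arguments edge_private R n eps delta : clear implicits.

Definition risk (R : realType) n (p : R) (theta : Rvec R n)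
    (M : mechanism R n) : \bar R :=
  (\sum_(G : graph n) (graph_prob p G)%:E *
     \sum_(y : outcomes G) (outcome_prob theta y)%:E *
       \int[M G y]_x (sqdist x theta)%:E)%E.

(* Main.v *)
Require Import Defs.
From mathcomp Require Import all_boot all_order all_algebra.
From mathcomp Require Import all_classical all_reals all_analysis.
From mathcomp Require Import measurable_realfun ring lra zify.

Import Order.TTheory GRing.Theory Num.Theory.
Local Open Scope classical_set_scope.
Local Open Scope ring_scope.

(** Both terms of the bound come from Assouad's method on one hypercube of
    parameters. For a scale [h] in [0, 1] and a sign vector [v], the vertex
    [cube h v] has entry [+h] or [-h] at each item [k] of the first half,
    according to [v k], and the opposite entry at the mirror item
    [rev_ord k]; it is thus centred and lies in [Theta]. An estimate has
    squared error at least [h ^+ 2] at each coordinate where its sign is wrong,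
    so the worst risk is at least [h ^+ 2] times the number of coordinates
    (at least [n / 4]) times the error of the test that decides [v k] from the
    sign of the [k]-th output coordinate.

    Flipping [v k] moves the win probabilities of the edges that touch [k] or
    [rev_ord k] only, each by at most [4 * h], and the mean number of such
    observed edges is at most [4 * n * p]. A bound on the testing error given
    the graph that is affine in that number (1/2 minus [L] times the number)
    can therefore be averaged over the graph directly, with no concentration
    of the degrees, and it suffices that [L * (n * p)] be small
    ([risk_lower_bound]). There are two such bounds.

    - Statistical ([test_nonprivate]): an affinity of two product Bernoulli
      laws is a product over the edges, each factor being one minus a multiple
      of the squared change of bias, so [L] is of order [h ^+ 2]. Taking
      [h ^+ 2] of order [1 / (n * p)] gives the risk [n * h ^+ 2], of order
      [1 / p].

    - Private ([test_private]): changing one outcome moves the probability of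
      any output event by at most a constant times [eps], plus [delta]. If the
      biases are changed one edge at a time, the mean of such a function moves
      by that amount times the change of bias. So [L] is of order
      [h * (eps + delta)]. Taking [h] to be the minimum of 1 and a small
      multiple of [1 / (n * p * eps)] gives the second term; the condition on
      [delta] is what makes [h * delta * (n * p)] small when [h <= 1].

    The lower bound on [p] gives [1 <= n * p], which is what keeps [h <= 1] in
    the statistical case. *)

(** * Functions of independent Bernoulli variables *)

Definition flip {I : finType} (x : I) (y : {ffun I -> bool}) :
  {ffun I -> bool} := [ffun i => y i (+) (i == x)].

Lemma flipK {I : finType} (x : I) : involutive (flip x).
Proof. by move=> y; apply/ffunP => i; rewrite !ffunE -addbA addbb addbF. Qed.

Definition prod_pmf {R : realType} {I : finType} (q : I -> R)
  (y : {ffun I -> bool}) : R := \prod_i bernoulli_pmf (q i) (y i).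

Lemma sum_bernoulli_pmf (R : realType) (a : R) :
  \sum_b bernoulli_pmf a b = 1.
Proof. by rewrite big_bool /bernoulli_pmf /= addrC subrK. Qed.

Lemma sum_prod_pmf (R : realType) (I : finType) (q : I -> R) :
  \sum_y prod_pmf q y = 1.
Proof.
rewrite -(bigA_distr_bigA (fun i => bernoulli_pmf (q i))) /=.
by apply: big1 => i _; exact: sum_bernoulli_pmf.
Qed.

Lemma prod_pmf_ge0 (R : realType) (I : finType) (q : I -> R)
  (hq : forall i, 0 <= q i <= 1) (y : {ffun I -> bool}) : 0 <= prod_pmf q y.
Proof. by apply: prodr_ge0 => i _; exact: bernoulli_pmf_ge0. Qed.

(** Pairing [y] with [flip x y] turns the difference of means into a sum of
    increments [f y - f (flip x y)], each weighted by the change of bias at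
    [x] and by the law of the other coordinates. *)
Lemma expectation_one_bias (R : realType) (I : finType) (x : I) (q q' : I -> R)
    (B : R) (f : {ffun I -> bool} -> R) :
  (forall i, 0 <= q i <= 1) -> (forall i, i != x -> q i = q' i) ->
  (forall y, `|f y - f (flip x y)| <= B) ->
  \sum_y prod_pmf q y * f y - \sum_y prod_pmf q' y * f y <= `|q x - q' x| * B.
Proof.
move=> q01 qq' fB.
(* The common weight of all coordinates other than x; it has total mass 2
   because each configuration of the others is counted for both values at x. *)
pose W (y : {ffun I -> bool}) := \prod_(i | i != x) bernoulli_pmf (q i) (y i).
have qE y : prod_pmf q y = bernoulli_pmf (q x) (y x) * W y.
  by rewrite /prod_pmf (bigD1 x).
have q'E y : prod_pmf q' y = bernoulli_pmf (q' x) (y x) * W y.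
  rewrite /prod_pmf (bigD1 x)//; congr (_ * _).
  by apply: eq_bigr => i ix; rewrite qq'.
have W_ge0 y : 0 <= W y.
  by apply: prodr_ge0 => i _; exact: bernoulli_pmf_ge0.
have WF y : W (flip x y) = W y.
  by apply: eq_bigr => i ix; rewrite ffunE (negbTE ix) addbF.
have flipx y : flip x y x = ~~ y x by rewrite ffunE eqxx addbT.
have sumF (g : {ffun I -> bool} -> R) : \sum_y g y = \sum_y g (flip x y).
  by rewrite (reindex_inj (inv_inj (flipK x))).
have sumW : \sum_y W y = 2.
  have -> : \sum_y W y = \sum_y (prod_pmf q y + prod_pmf q (flip x y)).
    apply: eq_bigr => y _; rewrite !qE WF flipx /bernoulli_pmf.
    by case: (y x) => /=; ring.
  by rewrite big_split /= -sumF sum_prod_pmf.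
pose D y := prod_pmf q y - prod_pmf q' y.
have -> : \sum_y prod_pmf q y * f y - \sum_y prod_pmf q' y * f y =
          \sum_y D y * f y.
  by rewrite -sumrB; apply: eq_bigr => y _; rewrite mulrBl.
have DF y : D (flip x y) = - D y.
  rewrite /D !qE !q'E !WF !flipx /bernoulli_pmf.
  by case: (y x) => /=; ring.
have DW y : `|D y| = W y * `|q x - q' x|.
  rewrite /D qE q'E -mulrBl normrM (ger0_norm (W_ge0 y)) mulrC.
  congr (_ * _); rewrite /bernoulli_pmf; case: (y x) => //.
  by rewrite distrC; congr `|_|; ring.
have H : 2 * (\sum_y D y * f y) <= \sum_y W y * (`|q x - q' x| * B).
  rewrite mulr_natl mulr2n {2}sumF -big_split /=; apply: ler_sum => y _.
  rewrite DF mulNr -mulrBr mulrA -DW.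
  by apply: le_trans (ler_norm _) _; rewrite normrM ler_wpM2l.
by move: H; rewrite -mulr_suml sumW ler_pM2l.
Qed.

(** A hybrid argument: the biases [q i] are replaced by [q' i] one index at a
    time. The bound is linear in the change of bias, which gives the dependence
    on the signal size needed under privacy without coupling the two laws. *)
Lemma expectation_bounded_difference (R : realType) (I : finType)
    (q q' : I -> R) (B : R) (f : {ffun I -> bool} -> R) :
  (forall i, 0 <= q i <= 1) -> (forall i, 0 <= q' i <= 1) ->
  (forall x y, `|f y - f (flip x y)| <= B) ->
  \sum_y prod_pmf q y * f y - \sum_y prod_pmf q' y * f y <=
  (\sum_i `|q i - q' i|) * B.
Proof.
move=> q01 q'01 fB.
pose mix (s : seq I) i := if i \in s then q' i else q i.
have mix01 s i : 0 <= mix s i <= 1 by rewrite /mix; case: ifP.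
have hybrid s : uniq s ->
    \sum_y prod_pmf q y * f y - \sum_y prod_pmf (mix s) y * f y <=
    (\sum_(i <- s) `|q i - q' i|) * B.
  elim: s => [_|x s IH /= /andP[xs us]].
    by rewrite big_nil mul0r subr_le0.
  rewrite big_cons mulrDl -(subrKA (\sum_y prod_pmf (mix s) y * f y)) addrC.
  apply: lerD; last exact: IH.
  have := @expectation_one_bias R I x (mix s) (mix (x :: s)) B f
    (mix01 s) _ (fB x).
  have -> : mix s x = q x by rewrite /mix (negbTE xs).
  have -> : mix (x :: s) x = q' x by rewrite /mix mem_head.
  apply.
  by move=> i ix; rewrite /mix in_cons (negbTE ix).
have := hybrid (index_enum I) (index_enum_uniq I).
congr (_ - _ <= _); apply: eq_bigr => y _; congr (_ * _).
by apply: eq_bigr => i _; rewrite /mix mem_index_enum.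
Qed.

Lemma prod_ge_1Bsum (R : realType) (I : finType) (a : I -> R) :
  (forall i, 0 <= a i <= 1) -> 1 - \sum_i a i <= \prod_i (1 - a i).
Proof.
move=> a01.
suff [] : 1 - \sum_i a i <= \prod_i (1 - a i) /\
    0 <= \prod_i (1 - a i) <= 1 by [].
elim/big_rec2 : _ => [|i s t _ [IH /andP[t0 t1]]].
  by rewrite subr0 lexx ler01.
have /andP[a0 a1] := a01 i.
by split; [nra|apply/andP; split; nra].
Qed.

(** Two product laws are hard to tell apart when their biases are close: the
    error of any randomized test [f] is bounded below by an affinity of the
    laws. The affinity used has density [H], the product over the coordinates
    of the harmonic means [g] of the two probabilities. It factorizes as the
    Hellinger affinity does and lies below it, so no square root is needed. *)
Lemma testing_error_ge (R : realType) (I : finType) (k : R) (q q' : I -> R)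
    (f : {ffun I -> bool} -> R) :
  0 < k -> (forall i, k <= q i <= 1 - k) -> (forall i, k <= q' i <= 1 - k) ->
  (forall y, 0 <= f y <= 1) ->
  2^-1 - \sum_i (q i - q' i) ^+ 2 / (2 * k) <=
  \sum_y prod_pmf q y * (1 - f y) + \sum_y prod_pmf q' y * f y.
Proof.
move=> k0 qk q'k f01.
pose g i b := 2 * bernoulli_pmf (q i) b * bernoulli_pmf (q' i) b /
              (bernoulli_pmf (q i) b + bernoulli_pmf (q' i) b).
have pk (r : I -> R) (rk : forall i, k <= r i <= 1 - k) i b :
    k <= bernoulli_pmf (r i) b.
  by rewrite /bernoulli_pmf; have := rk i; case: b; lra.
have q01 i : 0 <= q i <= 1 by have := qk i; lra.
have q'01 i : 0 <= q' i <= 1 by have := q'k i; lra.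
have g_ge0 i b : 0 <= g i b.
  by rewrite /g; have := pk q qk i b; have := pk q' q'k i b => ? ?;
    rewrite divr_ge0 ?mulr_ge0 //; lra.
have gsq i b : g i b ^+ 2 <= bernoulli_pmf (q i) b * bernoulli_pmf (q' i) b.
  rewrite /g; have := pk q qk i b; have := pk q' q'k i b.
  move: (bernoulli_pmf (q' i) b) (bernoulli_pmf (q i) b) => v u vk uk.
  rewrite expr_div_n ler_pdivrMr; last by rewrite exprn_gt0 //; lra.
  have -> : (2 * u * v) ^+ 2 = u * v * (4 * u * v) by ring.
  have := sqr_ge0 (u - v) => uv.
  by rewrite ler_wpM2l ?mulr_ge0 //; [lra|lra|nra].
(* a i is the defect of affinity at coordinate i. *)
pose a i : R := 1 - \sum_b g i b.
have aE i : a i = (q i - q' i) ^+ 2 / ((q i + q' i) * (2 - q i - q' i)).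
  by rewrite /a big_bool /g /bernoulli_pmf /=; have := qk i; have := q'k i => ? ?;
    field; apply/andP; split; apply/eqP; lra.
have a_ge0 i : 0 <= a i.
  by rewrite aE divr_ge0 ?sqr_ge0 // mulr_ge0 //; have := qk i; have := q'k i; lra.
have a_le i : a i <= (q i - q' i) ^+ 2 / (2 * k).
  have := qk i; have := q'k i => hq' hq.
  by rewrite aE ler_wpM2l ?sqr_ge0 // lef_pV2 ?posrE ?mulr_gt0 //; (lra || nra).
have a_le1 i : a i <= 1.
  by rewrite /a lerBlDr lerDl sumr_ge0.
pose H (y : {ffun I -> bool}) := \prod_i g i (y i).
have sumH : 1 - \sum_i a i <= \sum_y H y.
  rewrite -(bigA_distr_bigA g) /=.
  apply: le_trans (@prod_ge_1Bsum _ _ a _) _.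
    by move=> i; rewrite a_ge0 a_le1.
  apply: ler_prod => i _.
  by rewrite subr_ge0 a_le1 /a opprB addrCA subrr addr0 lexx.
(* The weights 5/4 - f and 1/4 + f have product at least 1/4 when 0 <= f <= 1;
   by the AM-GM inequality their combination of P and Q then dominates the
   geometric mean of P and Q, hence h. *)
have pointwise y :
    H y - (prod_pmf q y + prod_pmf q' y) / 4 <=
    prod_pmf q y * (1 - f y) + prod_pmf q' y * f y.
  have H0 : 0 <= H y by apply: prodr_ge0.
  have HPQ : H y ^+ 2 <= prod_pmf q y * prod_pmf q' y.
    rewrite /H /prod_pmf -prodrXl -big_split /=.
    by apply: ler_prod => i _; rewrite exprn_ge0 //= gsq.
  have := @prod_pmf_ge0 _ _ q q01 y; have := @prod_pmf_ge0 _ _ q' q'01 y.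
  move: (prod_pmf q y) (prod_pmf q' y) (H y) H0 HPQ (f01 y).
  move=> P Q h h0 hPQ /andP[f0 f1] Q0 P0.
  have L0 : 0 <= P * (5 / 4 - f y) + Q * (1 / 4 + f y).
    by rewrite addr_ge0 // mulr_ge0 //; lra.
  suff : h <= P * (5 / 4 - f y) + Q * (1 / 4 + f y) by lra.
  rewrite -(@ler_pXn2r _ 2) ?nnegrE //.
  apply: le_trans hPQ _.
  have amgm : 4 * (P * (5 / 4 - f y) * (Q * (1 / 4 + f y))) <=
      (P * (5 / 4 - f y) + Q * (1 / 4 + f y)) ^+ 2.
    by rewrite -subr_ge0; set u := P * _; set v := Q * _;
      rewrite (_ : _ - _ = (u - v) ^+ 2) ?sqr_ge0 //; ring.
  apply: le_trans amgm.
  have PQ0 := mulr_ge0 P0 Q0.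
  have : 0 <= P * Q * (f y * (1 - f y)) by rewrite !mulr_ge0 //; lra.
  lra.
have : \sum_y (H y - (prod_pmf q y + prod_pmf q' y) / 4) <=
       \sum_y prod_pmf q y * (1 - f y) + \sum_y prod_pmf q' y * f y.
  by rewrite -big_split /=; apply: ler_sum => y _; exact: pointwise.
have -> : \sum_y (H y - (prod_pmf q y + prod_pmf q' y) / 4) = \sum_y H y - 2^-1.
  by rewrite sumrB -mulr_suml [in X in _ - X]big_split /= !sum_prod_pmf; field.
have : \sum_i a i <= \sum_i (q i - q' i) ^+ 2 / (2 * k) by apply: ler_sum.
lra.
Qed.

(** * Win probabilities *)

(** The least probability of winning between items of scores -1 and 1. *)
Definition min_win_prob (R : realType) : R := (1 + expR 2)^-1.

Lemma min_win_prob_gt0 (R : realType) : 0 < min_win_prob R.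
Proof. by rewrite invr_gt0 addr_gt0 ?expR_gt0. Qed.

Lemma win_prob_bounds (R : realType) n (theta : Rvec R n) (e : vpair n) :
  (forall i, `|tnth theta i| <= 1) ->
  min_win_prob R <= win_prob theta e <= 1 - min_win_prob R.
Proof.
move=> t1; rewrite /win_prob.
have := t1 (val e).1; have := t1 (val e).2.
move: (tnth _ (val e).1) (tnth _ (val e).2) => a b.
rewrite !ler_norml => /andP[b0 b1] /andP[a0 a1] /=.
have ratio_ge (x y : R) : x <= 1 -> -1 <= y ->
    min_win_prob R <= expR y / (expR y + expR x).
  move=> x1 y1; rewrite ler_pdivlMr ?addr_gt0 ?expR_gt0 //.
  rewrite mulrC ler_pdivrMr ?addr_gt0 ?expR_gt0 // mulrDr mulr1 lerD2l.
  rewrite -expRD ler_expR; lra.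
rewrite ratio_ge //=.
suff : min_win_prob R <= 1 - expR a / (expR a + expR b) by lra.
have -> : 1 - expR a / (expR a + expR b) = expR b / (expR b + expR a).
  have := expR_gt0 a; have := expR_gt0 b => b_gt0 a_gt0.
  by field; rewrite !lt0r_neq0 ?addr_gt0.
exact: ratio_ge.
Qed.

(** The logistic function is 1-Lipschitz: after reduction to a common
    denominator the numerator is controlled by [1 + x <= expR x]. *)
Lemma win_prob_lipschitz (R : realType) n (theta theta' : Rvec R n)
    (e : vpair n) :
  `|win_prob theta e - win_prob theta' e| <=
  `|tnth theta (val e).1 - tnth theta' (val e).1| +
  `|tnth theta (val e).2 - tnth theta' (val e).2|.
Proof.
rewrite /win_prob.
move: (tnth theta (val e).1) (tnth theta (val e).2) => a b.
move: (tnth theta' (val e).1) (tnth theta' (val e).2) => a' b' /=.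
have half (x y x' y' : R) :
    expR x / (expR x + expR y) - expR x' / (expR x' + expR y') <=
    `|x - x'| + `|y - y'|.
  set N := `|x - x'| + _.
  have N0 : 0 <= N by rewrite addr_ge0.
  have Nge : (x - x') - (y - y') <= N.
    by apply: le_trans (ler_norm _) _; exact: ler_normB.
  have ex := expR_gt0 x; have ey := expR_gt0 y.
  have ex' := expR_gt0 x'; have ey' := expR_gt0 y'.
  have -> : expR x / (expR x + expR y) - expR x' / (expR x' + expR y') =
      (expR x * expR y' - expR x' * expR y) /
      ((expR x + expR y) * (expR x' + expR y')).
    by field; rewrite !lt0r_neq0 ?addr_gt0.
  rewrite ler_pdivrMr ?mulr_gt0 ?addr_gt0 //.
  have step : expR x * expR y' * (1 - N) <= expR x' * expR y.
    have -> : expR x' * expR y =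
        expR x * expR y' * expR (- ((x - x') - (y - y'))).
      by rewrite -!expRD; congr expR; ring.
    rewrite ler_pM2l ?mulr_gt0 //.
    by apply: le_trans (expR_ge1Dx _); lra.
  have : expR x * expR y' * N <= N * ((expR x + expR y) * (expR x' + expR y')).
    rewrite mulrC ler_wpM2l // mulrDl !mulrDr.
    by have := mulr_gt0 ex ex'; have := mulr_gt0 ey ex'; have := mulr_gt0 ey ey'; lra.
  lra.
by rewrite ler_norml half -(distrC a') -(distrC b') andbT lerNl opprB half.
Qed.

(** * The hypercube of parameters *)

Definition sgn_bool (R : realType) (b : bool) : R := if b then 1 else -1.

(** Opposite values at mirror items make the vector sum to zero whatever the
    signs are; for odd [n] the middle item, its own mirror, gets 0. *)
Definition spin (R : realType) n (v : {ffun 'I_n -> bool}) (i : 'I_n) : R :=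
  if (i < rev_ord i)%N then sgn_bool R (v i)
  else if (rev_ord i < i)%N then - sgn_bool R (v (rev_ord i)) else 0.

Definition cube (R : realType) (h : R) n (v : {ffun 'I_n -> bool}) : Rvec R n :=
  [tuple h * spin R n v i | i < n].

(** Flipping [v k] changes the parameter at [k] and at its mirror, hence the
    laws of the comparisons that involve either. *)
Definition touches n (k : 'I_n) (e : vpair n) : bool :=
  ((val e).1 \in [set k; rev_ord k]%SET) || ((val e).2 \in [set k; rev_ord k]%SET).

Lemma spin_rev (R : realType) n (v : {ffun 'I_n -> bool}) (i : 'I_n) :
  spin R n v (rev_ord i) = - spin R n v i.
Proof. by rewrite /spin rev_ordK; case: ltngtP; rewrite ?opprK ?oppr0. Qed.

Lemma normr_spin_le1 (R : realType) n (v : {ffun 'I_n -> bool}) (i : 'I_n) :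
  `|spin R n v i| <= 1.
Proof.
rewrite /spin /sgn_bool; case: ifP => _; [|case: ifP => _];
  rewrite ?normrN ?normr0 //; case: (v _); by rewrite ?normrN normr1.
Qed.

Lemma cube_normr_le1 (R : realType) (h : R) n (v : {ffun 'I_n -> bool}) i :
  0 <= h <= 1 -> `|tnth (cube R h n v) i| <= 1.
Proof.
move=> /andP[h0 h1]; rewrite tnth_mktuple normrM (ger0_norm h0).
by have := normr_spin_le1 R n v i; have := normr_ge0 (spin R n v i); nra.
Qed.

Lemma cube_Theta (R : realType) (h : R) n (v : {ffun 'I_n -> bool}) :
  0 <= h <= 1 -> Theta R n (cube R h n v).
Proof.
move=> h01; split.
  by apply: bigmax_le => // i _; exact: cube_normr_le1.
have anti : \sum_(i < n) tnth (cube R h n v) i = - \sum_(i < n) tnth (cube R h n v) i.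
  rewrite {1}(reindex_inj rev_ord_inj) /= -sumrN; apply: eq_bigr => i _.
  by rewrite !tnth_mktuple spin_rev mulrN.
by move: anti; lra.
Qed.

Lemma spin_flip (R : realType) n (v : {ffun 'I_n -> bool}) (k i : 'I_n) :
  `|spin R n v i - spin R n (flip k v) i| <= 2 * (i \in [set k; rev_ord k]%SET)%:R.
Proof.
case: (boolP (i \in _)) => [_|]; rewrite ?mulr1 ?mulr0.
  apply: le_trans (ler_normB _ _) _.
  by have := normr_spin_le1 R n v i; have := normr_spin_le1 R n (flip k v) i; lra.
rewrite !inE negb_or => /andP[ik irk].
rewrite /spin !ffunE (negbTE ik) -(inj_eq rev_ord_inj) rev_ordK (negbTE irk) !addbF.
by rewrite subrr normr0.
Qed.

Lemma win_prob_flip (R : realType) (h : R) n (v : {ffun 'I_n -> bool}) k e :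
  0 <= h ->
  `|win_prob (cube R h n v) e - win_prob (cube R h n (flip k v)) e| <=
  4 * h * (touches n k e)%:R.
Proof.
move=> h0; apply: le_trans (win_prob_lipschitz _ _ _ _ _) _.
rewrite !tnth_mktuple -!mulrBr !normrM (ger0_norm h0) -mulrDr (mulrC 4) -mulrA.
rewrite ler_wpM2l // /touches.
have := spin_flip R n v k (val e).1; have := spin_flip R n v k (val e).2.
move: (_ \in _) (_ \in _) => [] [] /=; lra.
Qed.

(** Each of the two items is the first end of at most [n] pairs and the second
    end of at most [n] pairs. *)
Lemma card_touches n (k : 'I_n) : (#|[pred e | touches n k e]| <= 4 * n)%N.
Proof.
have cardl w : (#|[pred e : vpair n | (val e).1 == w]| <= n)%N.
  rewrite -[X in (_ <= X)%N]card_ord.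
  rewrite -(@card_in_image _ _ (fun e : vpair n => (val e).2)) ?max_card //.
  move=> [[i j] ij] [[i' j'] ij']; rewrite !inE /= => /eqP w1 /eqP w2 w3.
  by apply: val_inj; rewrite /= w1 w2 w3.
have cardr w : (#|[pred e : vpair n | (val e).2 == w]| <= n)%N.
  rewrite -[X in (_ <= X)%N]card_ord.
  rewrite -(@card_in_image _ _ (fun e : vpair n => (val e).1)) ?max_card //.
  move=> [[i j] ij] [[i' j'] ij']; rewrite !inE /= => /eqP w1 /eqP w2 w3.
  by apply: val_inj; rewrite /= w1 w2 w3.
pose A w := [pred e : vpair n | (val e).1 == w].
pose B w := [pred e : vpair n | (val e).2 == w].
have cardU (X Y : pred (vpair n)) : (#|[predU X & Y]| <= #|X| + #|Y|)%N.
  by rewrite -cardUI leq_addr.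
have -> : #|[pred e | touches n k e]| =
    #|[predU [predU A k & A (rev_ord k)] & [predU B k & B (rev_ord k)]]|.
  by apply: eq_card => e; rewrite !inE /touches !inE.
apply: leq_trans (cardU _ _) _.
apply: leq_trans (leq_add (cardU _ _) (cardU _ _)) _.
have -> : (4 * n = (n + n) + (n + n))%N by lia.
by apply: leq_add; apply: leq_add; rewrite ?cardl ?cardr.
Qed.

(** * The number of comparisons affected by a sign *)

Lemma sum_graph_prob (R : realType) (p : R) n : \sum_(G : graph n) graph_prob p G = 1.
Proof.
transitivity (\prod_(e : vpair n) (p + (1 - p))).
  by rewrite bigA_distr /=; apply: eq_bigr => G _; apply: eq_bigr => e _;
    rewrite /bernoulli_pmf.
by apply: big1 => e _; rewrite addrC subrK.
Qed.

Lemma graph_prob_mem (R : realType) (p : R) n (e : vpair n) :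
  \sum_(G : graph n) graph_prob p G * (e \in G)%:R = p.
Proof.
transitivity (\prod_(d : vpair n) (p + (if d == e then 0 else 1 - p))).
  rewrite bigA_distr /=; apply: eq_bigr => G _.
  rewrite /graph_prob (bigD1 e) //= [RHS](bigD1 e) //= eqxx mulrAC.
  case: (e \in G); rewrite /bernoulli_pmf ?mulr0 ?mul0r // mulr1.
  by congr (_ * _); apply: eq_bigr => d /negbTE ->.
rewrite (bigD1 e) //= eqxx addr0 big1 ?mulr1 // => d /negbTE ->.
by rewrite addrC subrK.
Qed.

Lemma graph_prob_ge0 (R : realType) (p : R) n (G : graph n) :
  0 <= p <= 1 -> 0 <= graph_prob p G.
Proof. by move=> p01; apply: prodr_ge0 => e _; exact: bernoulli_pmf_ge0. Qed.

Lemma mean_touches (R : realType) (p : R) n (k : 'I_n) :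
  0 <= p ->
  \sum_(G : graph n) graph_prob p G *
    (\sum_(e : {e | e \in G}) (touches n k (val e))%:R) <= 4 * n%:R * p.
Proof.
move=> p0.
have -> : \sum_(G : graph n) graph_prob p G *
    (\sum_(e : {e | e \in G}) (touches n k (val e))%:R) =
    \sum_(e : vpair n) (touches n k e)%:R * p.
  under eq_bigr => G _.
    rewrite -(big_sub _ (fun e => (touches n k e)%:R)) big_mkcond mulr_sumr.
    over.
  rewrite exchange_big /=; apply: eq_bigr => e _.
  rewrite -[in RHS](graph_prob_mem R p n e) mulr_sumr; apply: eq_bigr => G _.
  by case: (e \in G); rewrite ?mulr1 ?mulr0 // mulrC.
rewrite -mulr_suml ler_wpM2r // -natr_sum -(natrM _ 4) ler_nat.
apply: leq_trans (card_touches n k); rewrite -sum1_card [leqRHS]big_mkcond.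
by apply: leq_sum => e _; rewrite inE; case: touches.
Qed.

(** * From squared error to sign errors *)

(** The probability of deciding the sign [b] wrongly when the positive sign is
    decided with probability [a]. *)
Definition sign_error (R : realType) (b : bool) (a : R) : R :=
  if b then 1 - a else a.

Definition nonneg_at (R : realType) n (k : 'I_n) : set (Rvec R n) :=
  [set x | 0 <= tnth x k].

Lemma measurable_nonneg_at (R : realType) n (k : 'I_n) :
  measurable (nonneg_at R n k).
Proof.
have -> : nonneg_at R n k =
    setT `&` (fun x : Rvec R n => tnth x k) @^-1` `[0, +oo[%classic.
  by apply/seteqP; split=> x; rewrite /nonneg_at /= in_itv /= andbT // => -[].
by apply: measurable_tnth => //; exact: measurable_itv.
Qed.

Lemma measurable_sqdist (R : realType) n (theta : Rvec R n) :
  measurable_fun setT (fun x : Rvec R n => sqdist x theta).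
Proof.
apply: measurable_sum => i.
by apply: measurable_funX; apply: measurable_funB => //; exact: measurable_tnth.
Qed.

(** At a coordinate whose true value is [h] or [-h], an estimate of the wrong
    sign is at distance at least [h]; integrating these indicators gives the
    probabilities of a wrong sign. *)
Lemma integral_sqdist_ge (R : realType) n (P : probability (Rvec R n) R)
    (h : R) (v : {ffun 'I_n -> bool}) : 0 <= h ->
  ((\sum_(k < n | (k < rev_ord k)%N)
      h ^+ 2 * sign_error R (v k) (fine (P (nonneg_at R n k))))%:E <=
   \int[P]_x (sqdist x (cube R h n v))%:E)%E.
Proof.
move=> h0.
pose B k := if v k then ~` nonneg_at R n k else nonneg_at R n k.
have mB k : measurable (B k).
  rewrite /B; case: (v k); [apply: measurableC|]; exact: measurable_nonneg_at.
have PB k : P (B k) = (sign_error R (v k) (fine (P (nonneg_at R n k))))%:E.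
  rewrite /B /sign_error; case: (v k).
    rewrite probability_setC; last exact: measurable_nonneg_at.
    rewrite EFinB fineK // fin_num_measure //; exact: measurable_nonneg_at.
  rewrite fineK // fin_num_measure //; exact: measurable_nonneg_at.
rewrite -big_filter; set s := [seq k <- _ | _].
have -> : (\sum_(k <- s)
      h ^+ 2 * sign_error R (v k) (fine (P (nonneg_at R n k))))%:E =
    (\int[P]_x (\sum_(k <- s) (h ^+ 2 * \1_(B k) x)%:E))%E.
  rewrite ge0_integral_sum //=; first last.
  - by move=> k x _; rewrite lee_fin mulr_ge0 ?sqr_ge0.
  - move=> k; apply/measurable_EFinP; apply: measurable_funM => //.
  rewrite -sumEFin; apply: eq_bigr => k _.
  under eq_integral do rewrite EFinM.
  rewrite ge0_integralZl_EFin ?sqr_ge0 //=; last by apply/measurable_EFinP.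
  rewrite integral_indic //.
  by rewrite setIT EFinM -PB.
apply: ge0_le_integral => //.
- by move=> x _; apply: sume_ge0 => k _; rewrite lee_fin mulr_ge0 ?sqr_ge0.
- by apply: emeasurable_sum => k; apply/measurable_EFinP; apply: measurable_funM.
- by apply/measurable_EFinP; exact: measurable_sqdist.
move=> x _; rewrite sumEFin lee_fin /sqdist big_filter big_mkcond /=.
apply: ler_sum => k _.
case: ifP => krk; last exact: sqr_ge0.
rewrite indicE; case: (boolP (x \in B k)); rewrite ?mulr0 ?sqr_ge0 // mulr1.
rewrite inE /B /nonneg_at tnth_mktuple /spin krk /sgn_bool.
case: (v k) => /= xk; last by rewrite mulrN1 opprK; nra.
by move/negP : xk; rewrite -ltNge mulr1; nra.
Qed.

Lemma outcome_prob_ge0 (R : realType) n (theta : Rvec R n) (G : graph n)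
  (y : outcomes G) : 0 <= outcome_prob theta y.
Proof.
apply: prodr_ge0 => e _; apply: bernoulli_pmf_ge0; rewrite /win_prob.
set a := tnth _ _; set b := tnth _ _.
have := expR_gt0 a; have := expR_gt0 b => b0 a0.
have ab := addr_gt0 a0 b0.
apply/andP; split; first exact: divr_ge0 (ltW a0) (ltW ab).
by rewrite ler_pdivrMr ?addr_gt0 // mul1r lerDl ltW.
Qed.

Definition sign_risk (R : realType) n (p h : R)
    (f : forall G : graph n, 'I_n -> outcomes G -> R)
    (v : {ffun 'I_n -> bool}) : R :=
  \sum_(G : graph n) graph_prob p G *
    \sum_(y : outcomes G) outcome_prob (cube R h n v) y *
      \sum_(k < n | (k < rev_ord k)%N) h ^+ 2 * sign_error R (v k) (f G k y).

Lemma risk_ge_sign_risk (R : realType) n (p h : R) (M : mechanism R n)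
    (v : {ffun 'I_n -> bool}) : 0 <= p <= 1 -> 0 <= h ->
  ((sign_risk R n p h (fun G k y => fine (M G y (nonneg_at R n k))) v)%:E <=
   risk p (cube R h n v) M)%E.
Proof.
move=> p01 h0; rewrite -sumEFin; apply: lee_sum => G _.
rewrite EFinM lee_wpmul2l ?lee_fin ?graph_prob_ge0 //.
rewrite -sumEFin; apply: lee_sum => y _.
by rewrite EFinM lee_wpmul2l ?lee_fin ?outcome_prob_ge0 // integral_sqdist_ge.
Qed.

(** * Assouad's method *)

Lemma card_lower_half n : (2 <= n)%N ->
  (n <= 4 * #|[pred k : 'I_n | (k < rev_ord k)%N]|)%N.
Proof.
move=> n2.
have hn : (n./2 <= n)%N by lia.
rewrite -sum1_card.
rewrite (eq_bigl (fun k : 'I_n => k < n./2)%N); last first.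
  by move=> k; rewrite inE /=; have := ltn_ord k; lia.
rewrite (big_ord_narrow hn) sum1_card card_ord; lia.
Qed.

(** The risk, averaged over all sign vectors, splits into a sum over [k] of
    testing errors; pairing [v] with [flip k v] makes each of them an average
    of two-point testing problems. With the mean number of affected edges at
    most [4 * n * p], the condition on [L] keeps each two-point error at least
    1/4, and some [v] does at least as badly as the average. *)
Lemma assouad (R : realType) n (p h L : R)
    (f : forall G : graph n, 'I_n -> outcomes G -> R) :
  (2 <= n)%N -> 0 <= p <= 1 -> 0 <= L -> 16 * L * (n%:R * p) <= 1 ->
  (forall (G : graph n) (k : 'I_n) (v : {ffun 'I_n -> bool}), v k ->
     2^-1 - L * (\sum_(e : {e | e \in G}) (touches n k (val e))%:R) <=
     \sum_y outcome_prob (cube R h n v) y * (1 - f G k y) +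
     \sum_y outcome_prob (cube R h n (flip k v)) y * f G k y) ->
  exists v : {ffun 'I_n -> bool}, 
    n%:R * h ^+ 2 / 32 <= sign_risk R n p h f v.
Proof.
move=> n2 p01 L0 Lnp test.
pose r := sign_risk R n p h f.
pose T (G : graph n) k v :=
  \sum_y outcome_prob (cube R h n v) y * sign_error R (v k) (f G k y).
pose U k v := \sum_(G : graph n) graph_prob p G * T G k v.
have rE v : r v = h ^+ 2 * \sum_(k < n | (k < rev_ord k)%N) U k v.
  rewrite /r /sign_risk /U exchange_big mulr_sumr /=; apply: eq_bigr => G _.
  rewrite -mulr_sumr mulrCA; congr (_ * _).
  rewrite /T exchange_big mulr_sumr /=; apply: eq_bigr => y _.
  by rewrite -mulr_sumr mulrCA mulr_sumr.
have Tpair (G : graph n) k v :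
    2^-1 - L * (\sum_(e : {e | e \in G}) (touches n k (val e))%:R) <=
    T G k v + T G k (flip k v).
  have fk w : flip k w k = ~~ w k by rewrite ffunE eqxx addbT.
  rewrite /T fk /sign_error; case: (boolP (v k)) => /= vk; first exact: test.
  by rewrite [leRHS]addrC; have := test G k (flip k v); rewrite fk vk flipK; exact.
have Upair k v : 4^-1 <= U k v + U k (flip k v).
  rewrite /U -big_split /=.
  have : \sum_(G : graph n) graph_prob p G *
      (2^-1 - L * (\sum_(e : {e | e \in G}) (touches n k (val e))%:R)) <=
      \sum_(G : graph n)
        (graph_prob p G * T G k v + graph_prob p G * T G k (flip k v)).
    by apply: ler_sum => G _; rewrite -mulrDr ler_wpM2l ?graph_prob_ge0.
  apply: le_trans.
  under eq_bigr do rewrite mulrBr mulrCA.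
  rewrite sumrB -mulr_suml -mulr_sumr sum_graph_prob.
  have := @mean_touches R p n k _; set m := \sum_(G : graph n) _ => mh.
  have {}mh : m <= 4 * n%:R * p by apply: mh; case/andP: p01.
  have := ler_wpM2l L0 mh; lra.
pose N : R := \sum_(v : {ffun 'I_n -> bool}) 1.
have Usum k : N / 8 <= \sum_v U k v.
  have : \sum_(v : {ffun 'I_n -> bool}) 4^-1 <= \sum_v (U k v + U k (flip k v)).
    by apply: ler_sum.
  have UF : \sum_v U k v = \sum_v U k (flip k v).
    by rewrite (reindex_inj (inv_inj (flipK k))).
  rewrite big_split /= -UF.
  have -> : \sum_(v : {ffun 'I_n -> bool}) 4^-1 = N / 4 :> R.
    by rewrite /N mulr_suml; apply: eq_bigr => v _; rewrite mul1r.
  lra.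
have N0 : 0 < N.
  by rewrite /N sumr_const card_ffun card_bool card_ord pmulrn_lgt0 // expn_gt0.
have rsum : N * (n%:R * h ^+ 2 / 32) <= \sum_v r v.
  under [leRHS]eq_bigr do rewrite rE.
  rewrite -mulr_sumr exchange_big /=.
  have : \sum_(k < n | (k < rev_ord k)%N) N / 8 <=
      \sum_(k < n | (k < rev_ord k)%N) \sum_v U k v.
    by apply: ler_sum.
  rewrite sumr_const => /(ler_wpM2l (sqr_ge0 h)); apply: le_trans.
  rewrite -mulr_natr.
  have := card_lower_half n n2; rewrite -(ler_nat R) natrM.
  set m := #|_|%:R => hm.
  have := ler_wpM2l (mulr_ge0 (ltW N0) (sqr_ge0 h)) hm.
  lra.
have [/existsP//|] := boolP [exists v, n%:R * h ^+ 2 / 32 <= r v].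
rewrite negb_exists => /forallP rlt; exfalso.
suff : \sum_v r v < N * (n%:R * h ^+ 2 / 32) by rewrite ltNge rsum.
rewrite /N mulr_suml; apply: ltr_sum.
  by apply/hasP; exists [ffun=> true]; rewrite ?mem_index_enum.
by move=> v _; rewrite mul1r ltNge rlt.
Qed.

(** * Testing errors of mechanisms *)

Definition nonneg_freq (R : realType) n (M : mechanism R n) (G : graph n)
    (k : 'I_n) (y : outcomes G) : R := fine (M G y (nonneg_at R n k)).

Lemma nonneg_freqE (R : realType) n (M : mechanism R n) (G : graph n)
    (k : 'I_n) (y : outcomes G) :
  M G y (nonneg_at R n k) = (nonneg_freq R n M G k y)%:E.
Proof.
by rewrite fineK // fin_num_measure //; exact: measurable_nonneg_at.
Qed.

Lemma nonneg_freq01 (R : realType) n (M : mechanism R n) (G : graph n)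
    (k : 'I_n) (y : outcomes G) : 0 <= nonneg_freq R n M G k y <= 1.
Proof.
rewrite -!lee_fin -nonneg_freqE measure_ge0 /=.
by apply: probability_le1; exact: measurable_nonneg_at.
Qed.

(** Holds for every mechanism: the outcomes themselves do not reveal a sign when
    the signal [h] is small compared with the inverse square root of the number
    of comparisons. *)
Lemma test_nonprivate (R : realType) n (M : mechanism R n) (h : R)
    (G : graph n) (k : 'I_n) (v : {ffun 'I_n -> bool}) : 0 <= h <= 1 ->
  2^-1 - 8 * h ^+ 2 / min_win_prob R *
           (\sum_(e : {e | e \in G}) (touches n k (val e))%:R) <=
  \sum_y outcome_prob (cube R h n v) y * (1 - nonneg_freq R n M G k y) +
  \sum_y outcome_prob (cube R h n (flip k v)) y * nonneg_freq R n M G k y.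
Proof.
move=> h01; have k0 := min_win_prob_gt0 R.
have qb w (e : {e | e \in G}) :
    min_win_prob R <= win_prob (cube R h n w) (val e) <= 1 - min_win_prob R.
  by apply: win_prob_bounds => i; exact: cube_normr_le1.
have := @testing_error_ge R {e | e \in G} (min_win_prob R) _ _ _ k0 (qb v)
  (qb (flip k v)) (nonneg_freq01 R n M G k).
apply: le_trans; rewrite lerD2l lerN2 mulr_sumr; apply: ler_sum => e _.
rewrite ler_pdivrMr ?mulr_gt0 //.
have -> : 8 * h ^+ 2 / min_win_prob R * (touches n k (val e))%:R *
      (2 * min_win_prob R) =
    (4 * h * (touches n k (val e))%:R) ^+ 2.
  by rewrite exprMn -(natrX _ _ 2) (_ : (touches _ _ _ ^ 2)%N = touches n k (val e));
    [field; exact: lt0r_neq0|case: touches].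
rewrite -real_normK ?num_real // ler_pXn2r ?nnegrE //; last first.
  by have /andP[h0 _] := h01; rewrite !mulr_ge0.
by apply: win_prob_flip; case/andP: h01.
Qed.

Lemma expR_sub1_le (R : realType) (x : R) : 0 <= x <= 1 -> expR x - 1 <= expR 1 * x.
Proof.
move=> /andP[x0 x1].
have : expR x * (1 - x) <= 1.
  have := expR_ge1Dx (- x); have := expRxMexpNx_1 x; have := expR_gt0 x.
  by nra.
have : expR x * x <= expR 1 * x by rewrite ler_wpM2r // ler_expR.
lra.
Qed.

(** Privacy makes output probabilities stable under the change of one outcome:
    the multiplicative factor costs [expR eps - 1], of order [eps], since the
    probabilities are at most 1. *)
Lemma private_bounded_difference (R : realType) n (eps delta : R) (M : mechanism R n)
    (G : graph n) (k : 'I_n) (x : {e | e \in G}) (y : outcomes G) :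
  0 < eps -> eps < 1 -> 0 <= delta -> edge_private R n eps delta M ->
  `|nonneg_freq R n M G k y - nonneg_freq R n M G k (flip x y)| <=
  expR 1 * eps + delta.
Proof.
move=> e0 e1 d0 Mpriv.
have half (z z' : outcomes G) : adjacent_data z z' ->
    nonneg_freq R n M G k z - nonneg_freq R n M G k z' <= expR 1 * eps + delta.
  move=> zz'; have := Mpriv G z z' zz' _ (measurable_nonneg_at R n k).
  rewrite !nonneg_freqE -EFinM -EFinD lee_fin.
  have eps01 : 0 <= eps <= 1 by rewrite !ltW.
  have hexp := expR_sub1_le R eps eps01.
  have /andP[_ f1] := nonneg_freq01 R n M G k z'.
  have exp1 : 0 <= expR eps - 1 by rewrite subr_ge0 -expR0 ler_expR ltW.
  have := ler_wpM2l exp1 f1; lra.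
have adj z : adjacent_data z (flip x z).
  rewrite /adjacent_data (_ : [set e | _]%SET = [set x]%SET) ?cards1 //.
  by apply/setP => e; rewrite !inE ffunE; case: (z e); case: (e == x).
rewrite ler_norml half ?andbT // lerNl opprB half //.
by have := adj (flip x y); rewrite flipK.
Qed.

(** Linear in [h], with the small factor [expR 1 * eps + delta]: when [eps]
    is small compared with [h] this beats the quadratic statistical bound, so
    larger values of [h] are possible. *)
Lemma test_private (R : realType) n (eps delta : R) (M : mechanism R n) (h : R)
    (G : graph n) (k : 'I_n) (v : {ffun 'I_n -> bool}) :
  0 < eps -> eps < 1 -> 0 <= delta -> edge_private R n eps delta M ->
  0 <= h <= 1 ->
  2^-1 - 4 * h * (expR 1 * eps + delta) *
           (\sum_(e : {e | e \in G}) (touches n k (val e))%:R) <=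
  \sum_y outcome_prob (cube R h n v) y * (1 - nonneg_freq R n M G k y) +
  \sum_y outcome_prob (cube R h n (flip k v)) y * nonneg_freq R n M G k y.
Proof.
move=> e0 e1 d0 Mpriv h01.
have q01 w (e : {e | e \in G}) : 0 <= win_prob (cube R h n w) (val e) <= 1.
  have := @win_prob_bounds R n (cube R h n w) (val e).
  have := min_win_prob_gt0 R => k0 /(_ (fun i => cube_normr_le1 R h n w i h01)).
  lra.
set f := nonneg_freq R n M G k.
have := @expectation_bounded_difference R {e | e \in G} _ _ _ f (q01 v)
  (q01 (flip k v)) (fun x y =>
    private_bounded_difference R n eps delta M G k x y e0 e1 d0 Mpriv).
have -> : \sum_y outcome_prob (cube R h n v) y * (1 - f y) =
    1 - \sum_y outcome_prob (cube R h n v) y * f y.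
  under eq_bigr do rewrite mulrBr mulr1.
  by rewrite sumrB (sum_prod_pmf R {e | e \in G} (fun e => win_prob _ (val e))).
rewrite -/(outcome_prob _ _) /prod_pmf -/(outcome_prob _ _).
set B := expR 1 * eps + delta.
have B0 : 0 <= B by rewrite addr_ge0 // mulr_ge0 ?expR_ge0 // ltW.
have sumq : \sum_(i : {e | e \in G}) `|win_prob (cube R h n v) (val i) -
       win_prob (cube R h n (flip k v)) (val i)| <=
    4 * h * (\sum_(e : {e | e \in G}) (touches n k (val e))%:R).
  by rewrite mulr_sumr; apply: ler_sum => e _; apply: win_prob_flip; case/andP: h01.
have := ler_wpM2r B0 sumq.
rewrite /outcome_prob; lra.
Qed.

(** * The minimax lower bound *)

Lemma risk_lower_bound (R : realType) n (p h L : R) (M : mechanism R n) :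
  (2 <= n)%N -> 0 <= p <= 1 -> 0 <= h <= 1 -> 0 <= L ->
  16 * L * (n%:R * p) <= 1 ->
  (forall (G : graph n) (k : 'I_n) (v : {ffun 'I_n -> bool}), v k ->
     2^-1 - L * (\sum_(e : {e | e \in G}) (touches n k (val e))%:R) <=
     \sum_y outcome_prob (cube R h n v) y * (1 - nonneg_freq R n M G k y) +
     \sum_y outcome_prob (cube R h n (flip k v)) y * nonneg_freq R n M G k y) ->
  ((n%:R * h ^+ 2 / 32)%:E <=
   ereal_sup [set risk p theta M | theta in Theta R n])%E.
Proof.
move=> n2 p01 h01 L0 Lnp test.
have [v hv] := @assouad R n p h L (nonneg_freq R n M) n2 p01 L0 Lnp test.
apply: (@le_trans _ _ (risk p (cube R h n v) M)).
  apply: le_trans (@risk_ge_sign_risk R n p h M v p01 _); last by case/andP: h01.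
  by rewrite lee_fin.
by apply: ereal_sup_ubound; exists (cube R h n v) => //; exact: cube_Theta.
Qed.

Theorem theorem4p1 (R : realType) :
  exists C0 c0 c : R, [/\ 0 < C0, 0 < c0, 0 < c &
    forall (n : nat) (p eps delta : R), (2 <= n)%N ->
      C0 * ln n%:R / n%:R <= p -> p < 1 ->
      0 < eps -> eps < 1 ->
      0 <= delta -> delta <= c0 / (n%:R * p) ->
      ((c * (p^-1 + Num.min n%:R (n%:R * p ^+ 2 * eps ^+ 2)^-1))%:E <=
       ereal_inf [set ereal_sup [set risk p theta M | theta in Theta R n]
                 | M in edge_private R n eps delta])%E].
Proof.
pose kappa := min_win_prob R.
have kappa0 : 0 < kappa := min_win_prob_gt0 R.
have kappa1 : kappa <= 1.
  by rewrite invf_le1 ?addr_gt0 ?expR_gt0 // lerDl expR_ge0.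
(* The private scale is h = min 1 (a / (n p eps)); with this a, each of the
   contributions of eps and of delta to 16 L (n p) is at most 1/2. *)
pose a : R := (128 * expR 1)^-1.
have a0 : 0 < a by rewrite invr_gt0 mulr_gt0 ?expR_gt0.
have aE : a * expR 1 = 128^-1.
  by rewrite /a; field; rewrite lt0r_neq0 ?expR_gt0.
have a1 : a <= 1.
  have : 1 <= expR 1 :> R by rewrite -expR0 ler_expR.
  by move: aE a0; nra.
(* The constant C0 is 1 / ln 2, because ln n is at least ln 2. *)
have ln2 : 0 < ln 2 :> R by rewrite ln_gt0 // ltr1n.
pose c : R := Num.min (kappa / 128 / 32) (a ^+ 2 / 32).
exists (ln 2)^-1, 128^-1, (c / 2).
have c0 : 0 < c by rewrite lt_min !divr_gt0 // exprn_gt0.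
split; rewrite ?invr_gt0 ?divr_gt0 //.
move=> n p eps delta n2 hp p1 e0 e1 d0 hd.
have n0 : 0 < n%:R :> R by rewrite ltr0n; lia.
have np1 : 1 <= n%:R * p.
  rewrite mulrC -ler_pdivrMr //; apply: le_trans hp.
  rewrite ler_pM2r ?invr_gt0 // mulrC ler_pdivlMr // mul1r ler_ln ?posrE //.
  by rewrite ler_nat.
have p0 : 0 < p by rewrite -(pmulr_rgt0 _ n0); lra.
have p01 : 0 <= p <= 1 by rewrite !ltW.
have np0 : 0 < n%:R * p by lra.
apply: le_ereal_inf_tmp => _ [M Mpriv <-].
set S := ereal_sup _.
have nonprivate : ((c * p^-1)%:E <= S)%E.
  (* The largest scale allowed by risk_lower_bound with test_nonprivate. *)
  pose h := Num.sqrt (kappa / (128 * (n%:R * p))).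
  have h2 : h ^+ 2 = kappa / (128 * (n%:R * p)).
    by rewrite sqr_sqrtr // divr_ge0 ?ltW ?mulr_gt0.
  have h01 : 0 <= h <= 1.
    rewrite sqrtr_ge0 /= -(@ler_pXn2r _ 2) ?nnegrE ?sqrtr_ge0 // h2 expr1n.
    by rewrite ler_pdivrMr ?mulr_gt0 //; nra.
  apply: le_trans (@risk_lower_bound R n p h (8 * h ^+ 2 / kappa)
    M n2 p01 h01 _ _ _).
  - rewrite lee_fin h2.
    have -> : n%:R * (kappa / (128 * (n%:R * p))) / 32 = kappa / 128 / 32 * p^-1.
      by field; rewrite !lt0r_neq0.
    by rewrite ler_wpM2r ?ge_min ?lexx // invr_ge0 ltW.
  - by rewrite divr_ge0 ?(ltW kappa0) // mulr_ge0 ?sqr_ge0.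
  - rewrite h2 le_eqVlt; apply/orP; left; apply/eqP.
    move: (n%:R * p) (lt0r_neq0 np0) => x x0; clearbody kappa.
    field; rewrite x0 lt0r_neq0 //.
  - by move=> G k v _; exact: test_nonprivate.
have private : ((c * Num.min n%:R (n%:R * p ^+ 2 * eps ^+ 2)^-1)%:E <= S)%E.
  pose h := Num.min 1 (a / (n%:R * p * eps)).
  have npe0 : 0 < n%:R * p * eps by rewrite mulr_gt0.
  have h01 : 0 <= h <= 1.
    by rewrite le_min ler01 (divr_ge0 (ltW a0) (ltW npe0)) /= ge_min lexx.
  have hnpe : h * (n%:R * p * eps) <= a.
    by rewrite -ler_pdivlMr // ge_min lexx orbT.
  apply: le_trans (@risk_lower_bound R n p h (4 * h * (expR 1 * eps + delta))
    M n2 p01 h01 _ _ _).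
  - rewrite lee_fin.
    have m0 : 0 <= Num.min n%:R (n%:R * p ^+ 2 * eps ^+ 2)^-1.
      by rewrite le_min ler0n invr_ge0 !mulr_ge0 // ?sqr_ge0 // ltW.
    apply: (@le_trans _ _ (a ^+ 2 / 32 *
      Num.min n%:R (n%:R * p ^+ 2 * eps ^+ 2)^-1)).
      by rewrite ler_wpM2r // ge_min lexx orbT.
    rewrite mulrAC ler_pM2r ?invr_gt0 //.
    rewrite /h; case: (leP 1 (a / (n%:R * p * eps))) => _.
      rewrite expr1n mulr1.
      apply: (@le_trans _ _ (1 * n%:R)); last by rewrite mul1r.
      apply: ler_pM; rewrite ?sqr_ge0 // ?ge_min ?lexx //.
      by rewrite expr_le1 // ltW.
    apply: (@le_trans _ _ (a ^+ 2 * (n%:R * p ^+ 2 * eps ^+ 2)^-1)).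
      by rewrite ler_wpM2l ?sqr_ge0 // ge_min lexx orbT.
    rewrite le_eqVlt; apply/orP; left; apply/eqP.
    by field; rewrite !lt0r_neq0.
  - by case/andP: h01 => h0 _; rewrite !mulr_ge0 // addr_ge0 // mulr_ge0 ?expR_ge0 // ltW.
  - have dnp : delta * (n%:R * p) <= 128^-1 by rewrite -ler_pdivlMr.
    have dh : h * (delta * (n%:R * p)) <= 128^-1.
      have dnp0 : 0 <= delta * (n%:R * p) by rewrite mulr_ge0 // ltW.
      by case/andP: h01 => h0 h1; nra.
    have := ler_wpM2r (expR_ge0 1) hnpe; rewrite aE.
    lra.
  - by move=> G k v _; exact: test_private.
set A := c * p^-1 in nonprivate; set B := c * Num.min _ _ in private.
apply: (@le_trans _ _ (Num.max A B)%:E); last by case: (leP A B).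
rewrite lee_fin mulrAC mulrDr -/A -/B.
by case: (leP A B); lra.
Qed.
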